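(* Let $e_1,\ldots,e_{30}$ be the standard basis vectors of $\mathbb{R}^{30}$, and for $i=1,\ldots,30$ let $u_i := e_i+e_{i+1}\in\mathbb{Z}^{30}$, with indices cyclic modulo $30$ (so $u_{30}=e_{30}+e_1$). Let $$Q := \operatorname{conv}\bigl(\{(u_1,332),\,(u_1,333)\}\cup\{(u_i,0),\,(u_i,1) : 2\le i\le 30\}\bigr)\subset\mathbb{R}^{30}\times\mathbb{R}=\mathbb{R}^{31}.$$ Then the Cartesian product $Q\times Q\subset\mathbb{R}^{62}$ is a $58$-dimensional lattice polytope with $3600$ vertices which is very ample, is not IDP, and has a non-unimodal $h^*$-vector.
   Context: A lattice polytope $P\subset\mathbb{R}^n$ is the convex hull of finitely many points of $\mathbb{Z}^n$ (it need not be full-dimensional). Its Ehrhart polynomial $E_P(t)$ is the unique polynomial with $E_P(k)=|kP\cap\mathbb{Z}^n|$ for all integers $k\ge 1$. If $d=\dim P$, the $h^*$-polynomial $h^*_P(t)=\sum_{i=0}^d h^*_i t^i$ is defined by $$\sum_{k=0}^\infty E_P(k)\,t^k=\frac{h^*_P(t)}{(1-t)^{d+1}},$$ and $(h^*_0,\ldots,h^*_d)$ is the $h^*$-vector of $P$. The $h^*$-vector is unimodal if there is $j\in\{0,\ldots,d\}$ with $h^*_0\le h^*_1\le\cdots\le h^*_j\ge h^*_{j+1}\ge\cdots\ge h^*_d$; otherwise it is non-unimodal. $P$ is IDP if for every integer $k\ge 2$ each lattice point in $kP$ (element of $kP\cap\mathbb{Z}^n$) is a sum of $k$ lattice points in $P$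 (elements of $P\cap\mathbb{Z}^n$, repetitions allowed). $P$ is very ample if there exists a positive integer $N$ such that for every integer $k\ge N$ each lattice point in $kP$ is a sum of $k$ lattice points in $P$. *)

(* Defs.v *)
From HB Require Import structures.
From mathcomp Require Import all_boot all_order all_algebra.
From mathcomp Require Import all_classical all_reals.

Set Implicit Arguments.
Unset Strict Implicit.
Unset Printing Implicit Defensive.
Import Order.TTheory GRing.Theory Num.Theory.
Local Open Scope card_scope.
Local Open Scope classical_set_scope.
Local Open Scope ring_scope.

Definition lattice (R : realType) (n : nat) : set 'rV[R]_n :=
  [set x | forall i, x 0 i \is a Num.int].
Arguments lattice : clear implicits.

Definition conv (R : realType) (n : nat) (A : set 'rV[R]_n) : set 'rV[R]_n :=
  [set x | exists (m : nat) (p : 'I_m -> 'rV[R]_n) (w : 'I_m -> R),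
     [/\ forall i, A (p i), forall i, 0 <= w i, \sum_i w i = 1
       & x = \sum_i w i *: p i]].

Definition lattice_polytope (R : realType) (n : nat) (P : set 'rV[R]_n) : Prop :=
  exists A : set 'rV[R]_n, [/\ finite_set A, A `<=` lattice R n & P = conv A].

Definition dilate (R : realType) (n : nat) (k : nat) (P : set 'rV[R]_n) :
    set 'rV[R]_n :=
  [set k%:R *: x | x in P].

Definition lattice_points (R : realType) (n : nat) (P : set 'rV[R]_n) :
    set 'rV[R]_n :=
  P `&` lattice R n.

(* [U] is the direction space of the affine hull of [P]. *)
Definition has_dim (R : realType) (n : nat) (P : set 'rV[R]_n) (d : nat) : Prop :=
  P !=set0 /\
  exists U : {vspace 'rV[R]_n},
    [/\ \dim U = d,
        forall x y, P x -> P y -> x - y \in U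
      & forall W : {vspace 'rV[R]_n},
          (forall x y, P x -> P y -> x - y \in W) -> (U <= W)%VS].

(* Vertices are the 0-dimensional faces: points at which some linear functional
   attains its maximum over [P] uniquely. *)
Definition vertices (R : realType) (n : nat) (P : set 'rV[R]_n) : set 'rV[R]_n :=
  [set v | P v /\ exists c : 'cV[R]_n,
     forall x, P x -> x != v -> (x *m c) 0 0 < (v *m c) 0 0].

Definition is_ehrhart (R : realType) (n : nat) (P : set 'rV[R]_n)
    (E : {poly rat}) : Prop :=
  forall k : nat, (1 <= k)%N ->
    exists2 m : nat, lattice_points (dilate k P) #= `I_m & E.[k%:R] = m%:R.

(* [h] is the h*-polynomial of the [d]-dimensional polytope [P]. The last clause
   is (1 - t)^(d+1) * \sum_k E(k) t^k = h(t) in Q[[t]], coefficient by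
   coefficient. *)
Definition is_hstar (R : realType) (n : nat) (P : set 'rV[R]_n) (d : nat)
    (h : {poly rat}) : Prop :=
  has_dim P d /\
  exists E : {poly rat},
    [/\ is_ehrhart P E, (size h <= d.+1)%N
      & forall k : nat,
          \sum_(i < k.+1) ((1 - 'X) ^+ d.+1 : {poly rat})`_i * E.[(k - i)%N%:R]
          = h`_k].

Definition unimodal (d : nat) (a : nat -> rat) : Prop :=
  exists2 j : nat, (j <= d)%N &
    (forall i, (i < j)%N -> a i <= a i.+1) /\
    (forall i, (j <= i < d)%N -> a i.+1 <= a i).

Definition nonunimodal_hstar (R : realType) (n : nat) (P : set 'rV[R]_n) : Prop :=
  exists (d : nat) (h : {poly rat}),
    is_hstar P d h /\ ~ unimodal d (fun i => h`_i).

Definition sum_of_lattice_points (R : realType) (n : nat) (P : set 'rV[R]_n)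
    (k : nat) (x : 'rV[R]_n) : Prop :=
  exists2 p : 'I_k -> 'rV[R]_n,
    forall i, lattice_points P (p i) & x = \sum_i p i.

Definition IDP (R : realType) (n : nat) (P : set 'rV[R]_n) : Prop :=
  forall k : nat, (2 <= k)%N ->
  forall x, lattice_points (dilate k P) x -> sum_of_lattice_points P k x.

Definition very_ample (R : realType) (n : nat) (P : set 'rV[R]_n) : Prop :=
  exists2 N : nat, (0 < N)%N &
    forall k : nat, (N <= k)%N ->
    forall x, lattice_points (dilate k P) x -> sum_of_lattice_points P k x.

Definition cartesian (R : realType) (m n : nat) (P : set 'rV[R]_m)
    (P' : set 'rV[R]_n) : set 'rV[R]_(m + n) :=
  [set x | P (lsubmx x) /\ P' (rsubmx x)].

(* Indices are shifted: [u i] is u_(i+1), and [ordS] is the cyclic successor. *)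
Definition u (R : realType) (i : 'I_30) : 'rV[R]_30 :=
  delta_mx 0 i + delta_mx 0 (ordS i).

Definition Q (R : realType) : set 'rV[R]_(30 + 1) :=
  conv ([set row_mx (u R ord0) 332%:M; row_mx (u R ord0) 333%:M] `|`
        [set x | exists2 i : 'I_30, i != ord0 &
                   x = row_mx (u R i) 0%:M \/ x = row_mx (u R i) 1%:M]).
Arguments Q : clear implicits.

Lemma has_dim_unique (R : realType) (n : nat) (P : set 'rV[R]_n) d d' :
  has_dim P d -> has_dim P d' -> d = d'.
Proof.
move=> [_ [U [<- PU Um]]] [_ [W [<- PW Wm]]].
by congr (\dim _); apply/eqP; rewrite eqEsubv Um // Wm.
Qed.

Lemma ehrhart_unique (R : realType) (n : nat) (P : set 'rV[R]_n) E E' :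
  is_ehrhart P E -> is_ehrhart P E' -> E = E'.
Proof.
move=> PE PE'; apply/eqP; rewrite -subr_eq0; apply/negPn/negP => D0.
pose s : seq rat := [seq k.+1%:R | k <- iota 0 (size (E - E'))].
have : (size s < size (E - E')%R)%N.
  apply: max_poly_roots => //.
    apply/allP => _ /mapP[k _ ->]; rewrite /root hornerD hornerN subr_eq0.
    have [m Pm ->] := PE k.+1 isT; have [m' Pm' ->] := PE' k.+1 isT.
    have : `I_m #= `I_m' by apply: card_eq_trans Pm'; rewrite card_eq_sym.
    by rewrite card_eq_le !card_le_II -eqn_leq => /eqP->.
  by rewrite map_inj_uniq ?iota_uniq // => i j /eqP; rewrite eqr_nat => /eqP[].
by rewrite size_map size_iota ltnn.
Qed.

Lemma hstar_unique (R : realType) (n : nat) (P : set 'rV[R]_n) d d' h h' :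
  is_hstar P d h -> is_hstar P d' h' -> d = d' /\ h = h'.
Proof.
move=> [Pd [E [PE _ Eh]]] [Pd' [E' [PE' _ Eh']]].
rewrite (has_dim_unique Pd' Pd) in Eh' *; split=> //.
by apply/polyP => k; rewrite -Eh -Eh' (ehrhart_unique PE PE').
Qed.

(* Main.v *)
Require Import Defs.
From Stdlib Require Import ZArith.
From mathcomp Require Import all_boot all_order all_algebra.
From mathcomp Require Import all_classical all_reals.
From mathcomp Require Import ssrZ zify ring lra.
Import Order.TTheory GRing.Theory Num.Theory.
Set Implicit Arguments.
Unset Strict Implicit.
Unset Printing Implicit Defensive.
Local Open Scope card_scope.
Local Open Scope classical_set_scope.
Local Open Scope ring_scope.

(** The polytope Q is the edge polytope of the cycle on 30 vertices, thickened
to height k in its k-th dilate, and with the edge u_1 lifted by 332. The only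
linear relation among the u_i is the alternating one, sum of the odd-numbered
u_i = sum of the even-numbered ones, because the cycle is even. Write s_i for
its coefficients +1, -1.

Points of kQ are the pairs (sum_i l_i u_i, z) with real l_i >= 0 of sum k and
332 l_1 <= z <= 332 l_1 + k ([dilateQ]). The base point determines l up to
adding a multiple of s, and such a change moves l_1, so it moves the window
available to z: this is where the holes come from. If the base point is
integral, then all l_i agree with s_i l_1 modulo integers ([alternating_int]),
so the base point also has an integral representation n, and two consecutive
ones n and n + s exist exactly when the coefficients on the side where s is -1
are all positive ([oddpos]; indices start at 0 in the code, so this is the side
of the odd i). Hence every lattice point of kQ has one normal form
(sum_i n_i u_i, 332 n_1 + r) with 0 <= r < 332 if one can still pass to n + s
and 0 <= r <= k otherwise ([lattice_points_dilateQ], [lattice_pt_inj]).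

Everything about lattice points is read off this normal form. A point with
r <= k is a sum of k lattice points of Q ([sum_lattice_pt]); for k >= 331 that
is always the case, so Q is very ample. For k = 15 the base point (1,...,1) has
the two representations with l_1 = 0 and l_1 = 1, and height 16 falls in the
hole between 15 and 332, so Q is not IDP. Counting, with C(k+29,29) vectors n
in total and C(k+14,29) of them satisfying the positivity condition, gives
  E_Q(k) = (k+1) (C(k+29,29) - C(k+14,29)) + 332 C(k+14,29)  ([card_codes]),
which is a polynomial of degree at most 29 since the difference of binomials
telescopes.

All properties pass to products: E_{QxQ} = E_Q^2, very ampleness and the
failure of IDP are inherited, dimensions add and vertices multiply. Finally
multiplication of a power series by (1-t)^59 is the 59-fold backward
difference of its coefficients, so the h*-polynomial exists because that
difference kills polynomials of degree at most 58, and its coefficients can be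
computed; they satisfy h*_25 > h*_26 < h*_27 ([hstarQQ_dip]). *)

(** * Convex hulls of finite families *)

Lemma card_image_finset (T : finType) (U : Type) (f : T -> U) (D : {set T}) :
  {in D &, injective f} -> f @` [set` D] #= `I_#|D|.
Proof.
move=> finj.
have -> : f @` [set` D] = (f \o @enum_val _ (mem D)) @` [set: 'I_#|D|].
  apply/seteqP; split=> _ [x Dx <-] /=; last first.
    by exists (enum_val x) => //=; exact: enum_valP.
  by exists (enum_rank_in Dx x) => //=; rewrite enum_rankK_in.
apply: card_eq_trans (inj_card_eq _) _; last by rewrite card_eq_sym card_II.
by move=> i j _ _ /finj/= ij; apply: enum_val_inj; apply: ij; exact: enum_valP.
Qed.

(** Weights of a convex combination can be collected along the fibres of the
parametrization, so one weight per index of a fixed finite family is enough. *)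
Lemma conv_range (R : realType) (n : nat) (I : finType) (g : I -> 'rV[R]_n) x :
  conv (range g) x <->
  exists w : I -> R, [/\ forall i, 0 <= w i, \sum_i w i = 1
                       & x = \sum_i w i *: g i].
Proof.
split=> [[m [p [w [gp w0 w1 ->]]]]|[w [w0 w1 ->]]].
  have /choice[a ga] : forall j, exists i, g i = p j.
    by move=> j; have [i _ <-] := gp j; exists i.
  exists (fun i => \sum_(j | a j == i) w j); split.
  - by move=> i; apply: sumr_ge0.
  - by rewrite -w1 [RHS](partition_big a xpredT).
  - rewrite (partition_big a xpredT)//=; apply: eq_bigr => i _.
    rewrite scaler_suml; apply: eq_bigr => j /eqP <-.
    by rewrite ga.
exists #|I|, (g \o enum_val), (w \o enum_val); split=> //=.
- by move=> i; exists (enum_val i).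
- by rewrite -w1 [RHS](reindex _ (onW_bij _ (@enum_val_bij I))).
- by rewrite [LHS](reindex _ (onW_bij _ (@enum_val_bij I))).
Qed.

Lemma dilate_conv_range (R : realType) (n : nat) (I : finType)
    (g : I -> 'rV[R]_n) (k : nat) x : (0 < k)%N ->
  dilate k (conv (range g)) x <->
  exists w : I -> R, [/\ forall i, 0 <= w i, \sum_i w i = k%:R
                       & x = \sum_i w i *: g i].
Proof.
move=> k0; have kR : k%:R != 0 :> R by rewrite pnatr_eq0 -lt0n.
split=> [[y /conv_range[w [w0 w1 ->]] <-]|[w [w0 w1 ->]]].
  exists (fun i => k%:R * w i); split.
  - by move=> i; rewrite mulr_ge0.
  - by rewrite -mulr_sumr w1 mulr1.
  - by rewrite scaler_sumr; apply: eq_bigr => i _; rewrite scalerA.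
exists (\sum_i (k%:R^-1 * w i) *: g i).
  apply/conv_range; exists (fun i => k%:R^-1 * w i); split=> //.
  - by move=> i; rewrite mulr_ge0 ?invr_ge0.
  - by rewrite -mulr_sumr w1 mulVf.
by rewrite scaler_sumr; apply: eq_bigr => i _; rewrite scalerA mulrA divff ?mul1r.
Qed.

Lemma row_mx_sum (V : nmodType) (m n : nat) (I : finType) (P : pred I)
    (a : I -> 'rV[V]_m) (b : I -> 'rV[V]_n) :
  \sum_(i | P i) row_mx (a i) (b i) =
  row_mx (\sum_(i | P i) a i) (\sum_(i | P i) b i).
Proof.
elim/big_rec3: _ => [|i x y z _ ->]; first by rewrite row_mx0.
by rewrite add_row_mx.
Qed.

Lemma cartesian_conv_range (R : realType) (m n : nat) (I J : finType)
    (g : I -> 'rV[R]_m) (g' : J -> 'rV[R]_n) :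
  cartesian (conv (range g)) (conv (range g')) =
  conv (range (fun ij : I * J => row_mx (g ij.1) (g' ij.2))).
Proof.
apply/seteqP; split=> x.
  move=> [/conv_range[w [w0 w1 xw]] /conv_range[v [v0 v1 xv]]].
  apply/conv_range; exists (fun ij => w ij.1 * v ij.2); split.
  - by move=> ij; rewrite mulr_ge0.
  - rewrite -(pair_bigA _ (fun i j => w i * v j))/= -w1.
    by apply: eq_bigr => i _; rewrite -mulr_sumr v1 mulr1.
  rewrite -[x]hsubmxK xw xv.
  rewrite -(pair_bigA _ (fun i j => (w i * v j) *: row_mx (g i) (g' j)))/=.
  transitivity (row_mx (\sum_i \sum_j (w i * v j) *: g i)
                       (\sum_i \sum_j (w i * v j) *: g' j)).
    congr row_mx.
      by apply: eq_bigr => i _; rewrite -scaler_suml -mulr_sumr v1 mulr1.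
    rewrite exchange_big; apply: eq_bigr => j _.
    by rewrite -scaler_suml -mulr_suml w1 mul1r.
  rewrite -(row_mx_sum xpredT).
  apply: eq_bigr => i _; rewrite -(row_mx_sum xpredT).
  by apply: eq_bigr => j _; rewrite scale_row_mx.
move=> /conv_range[w [w0 w1 xw]]; split.
  apply/conv_range; exists (fun i => \sum_j w (i, j)); split.
  - by move=> i; apply: sumr_ge0.
  - by rewrite -w1 (pair_bigA _ (fun i j => w (i, j))); apply: eq_bigr => -[].
  rewrite xw linear_sum /=.
  transitivity (\sum_i \sum_j w (i, j) *: g i).
    by rewrite pair_bigA; apply: eq_bigr => -[i j] _; rewrite linearZ /= row_mxKl.
  by apply: eq_bigr => i _; rewrite scaler_suml.
apply/conv_range; exists (fun j => \sum_i w (i, j)); split.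
- by move=> i; apply: sumr_ge0.
- rewrite -w1 exchange_big (pair_bigA _ (fun i j => w (i, j))).
  by apply: eq_bigr => -[].
rewrite xw linear_sum /=.
transitivity (\sum_i \sum_j w (i, j) *: g' j).
  by rewrite pair_bigA; apply: eq_bigr => -[i j] _; rewrite linearZ /= row_mxKr.
by rewrite exchange_big; apply: eq_bigr => i _; rewrite scaler_suml.
Qed.

(** Both directions of the description of the vertices compare a value with the
average of the values at the generators; this turns the comparison into a sum
of nonnegative terms. *)
Lemma convex_gap (R : realType) (n : nat) (I : finType) (g : I -> 'rV[R]_n)
    (w : I -> R) (c : 'cV[R]_n) (a : R) : \sum_i w i = 1 ->
  \sum_i w i * (a - (g i *m c) 0 0) = a - ((\sum_i w i *: g i) *m c) 0 0.
Proof.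
move=> w1; under eq_bigr do rewrite mulrBr.
rewrite sumrB -mulr_suml w1 mul1r mulmx_suml summxE; congr (_ - _).
by apply: eq_bigr => i _; rewrite -scalemxAl [RHS]mxE.
Qed.

Lemma conv_range_gen (R : realType) (n : nat) (I : finType) (g : I -> 'rV[R]_n) i :
  conv (range g) (g i).
Proof.
apply/conv_range; exists (fun j => (j == i)%:R); split=> //.
- by rewrite (bigD1 i) //= eqxx big1 ?addr0 // => j /negPf ->.
- by rewrite (bigD1 i) //= eqxx scale1r big1 ?addr0 // => j /negbTE ->; rewrite scale0r.
Qed.

(** If the maximum of a functional over the hull were attained only at a point
outside the family, that point would be an average of strictly smaller values.
Conversely a functional exposing a generator among the generators exposes it in
the whole hull, since equality forces all the weight onto that generator. *)
Lemma vertices_conv_range (R : realType) (n : nat) (I : finType)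
    (g : I -> 'rV[R]_n) :
  (forall i, exists c : 'cV[R]_n,
     forall j, g j != g i -> (g j *m c) 0 0 < (g i *m c) 0 0) ->
  vertices (conv (range g)) = range g.
Proof.
move=> gexp; apply/seteqP; split=> [v [/conv_range[w [w0 w1 vw]] [c cv]]|_ [i _ <-]].
  apply: contrapT => ng.
  have gv j : (g j *m c) 0 0 < (v *m c) 0 0.
    apply: cv; first exact: conv_range_gen.
    by apply/eqP => gj; apply: ng; exists j.
  have := convex_gap g c ((v *m c) 0 0) w1; rewrite -vw subrr => /psumr_eq0P w00.
  have : \sum_i w i = 0.
    apply: big1 => i _; apply/eqP.
    have /eqP : w i * ((v *m c) 0 0 - (g i *m c) 0 0) = 0.
      by apply: w00 => // j _; rewrite mulr_ge0 // subr_ge0 ltW.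
    by rewrite mulf_eq0 subr_eq0 (gt_eqF (gv i)) orbF.
  by rewrite w1 => /eqP; rewrite oner_eq0.
split; first exact: conv_range_gen.
have [c ci] := gexp i; exists c => x /conv_range[w [w0 w1 xw]] xi.
have le j : 0 <= (g i *m c) 0 0 - (g j *m c) 0 0.
  by rewrite subr_ge0; have [->|/ci/ltW//] := eqVneq (g j) (g i).
rewrite -subr_gt0 xw -convex_gap //.
rewrite lt_def sumr_ge0 ?andbT; last by move=> j _; rewrite mulr_ge0.
apply: contra xi => /eqP/psumr_eq0P w00.
apply/eqP; rewrite xw -[RHS]scale1r -w1 scaler_suml; apply: eq_bigr => j _.
have [->//|gji] := eqVneq (g j) (g i).
have /eqP := w00 (fun j _ => mulr_ge0 (w0 j) (le j)) j isT.
rewrite mulf_eq0 subr_eq0 => /orP[/eqP->|/eqP E]; first by rewrite !scale0r.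
by have := ci j gji; rewrite E ltxx.
Qed.

(** Exposing each member of a family by index, rather than by value, also makes
the family injective, so that vertices can be counted by counting indices. *)
Definition exposed (R : realType) (n : nat) (I : finType) (g : I -> 'rV[R]_n) :=
  forall i, exists c : 'cV[R]_n,
    forall j, j != i -> (g j *m c) 0 0 < (g i *m c) 0 0.

Lemma exposed_inj (R : realType) (n : nat) (I : finType) (g : I -> 'rV[R]_n) :
  exposed g -> injective g.
Proof.
move=> gexp i j gij; apply/eqP/negPn/negP => /negPf ij.
have [c ci] := gexp i; have := ci j; rewrite eq_sym ij gij ltxx => /(_ isT).
by [].
Qed.

Lemma card_vertices_conv_range (R : realType) (n : nat) (I : finType)
    (g : I -> 'rV[R]_n) :
  exposed g -> vertices (conv (range g)) #= `I_#|I|.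
Proof.
move=> gexp; rewrite vertices_conv_range.
  have -> : range g = g @` [set` [set: I]%SET].
    by congr (_ @` _); apply/seteqP; split => i //= _; rewrite inE.
  rewrite -[X in `I_X]cardsT; apply: card_image_finset.
  by move=> i j _ _; exact: exposed_inj.
move=> i; have [c ci] := gexp i; exists c => j gij; apply: ci.
by apply: contra_neq gij => ->.
Qed.

Lemma exposed_cartesian (R : realType) (m n : nat) (I J : finType)
    (g : I -> 'rV[R]_m) (g' : J -> 'rV[R]_n) :
  exposed g -> exposed g' ->
  exposed (fun ij : I * J => row_mx (g ij.1) (g' ij.2)).
Proof.
move=> ge ge' [i j]; have [c ci] := ge i; have [c' cj] := ge' j.
exists (col_mx c c') => -[i' j'] /=; rewrite !mul_row_col !mxE xpair_eqE negb_and.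
case/boolP: (i' == i) => [/eqP->/= j'j|ii _].
  by rewrite ltrD2l; have := cj _ j'j; rewrite !mxE.
apply: ltr_leD; first by have := ci _ ii; rewrite !mxE.
have [->//|/cj/ltW] := eqVneq j' j.
by rewrite !mxE.
Qed.

(** * Products of polytopes *)

Lemma dilate_cartesian (R : realType) (m n k : nat) (P : set 'rV[R]_m)
    (P' : set 'rV[R]_n) :
  dilate k (cartesian P P') = cartesian (dilate k P) (dilate k P').
Proof.
apply/seteqP; split=> x.
  move=> [y [Py P'y] <-]; split.
    by exists (lsubmx y); rewrite // linearZ.
  by exists (rsubmx y); rewrite // linearZ.
move=> [[y Py yx] [z Pz zx]]; exists (row_mx y z).
  by rewrite /cartesian /= row_mxKl row_mxKr.
by rewrite scale_row_mx yx zx hsubmxK.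
Qed.

Lemma lattice_points_cartesian (R : realType) (m n : nat) (P : set 'rV[R]_m)
    (P' : set 'rV[R]_n) :
  lattice_points (cartesian P P') =
  cartesian (lattice_points P) (lattice_points P').
Proof.
apply/seteqP; split=> x.
  by move=> [[Px P'x] xZ]; split; split=> // i; rewrite mxE.
move=> [[Px lx] [P'x rx]]; split=> // i; rewrite -[x]hsubmxK mxE.
by case: splitP => j _; [exact: lx | exact: rx].
Qed.

Lemma sum_of_lattice_points_cartesian (R : realType) (m n k : nat)
    (P : set 'rV[R]_m) (P' : set 'rV[R]_n) x :
  sum_of_lattice_points (cartesian P P') k x <->
  sum_of_lattice_points P k (lsubmx x) /\ sum_of_lattice_points P' k (rsubmx x).
Proof.
rewrite /sum_of_lattice_points lattice_points_cartesian.
split=> [[p pP ->]|[[p pP xp] [q qP xq]]].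
  split; [exists (lsubmx \o p)|exists (rsubmx \o p)];
    by [move=> i; have [] := pP i | rewrite linear_sum].
exists (fun i => row_mx (p i) (q i)).
  by move=> i; rewrite /cartesian /= row_mxKl row_mxKr.
by rewrite (row_mx_sum xpredT) -xp -xq hsubmxK.
Qed.

Lemma very_ample_cartesian (R : realType) (m n : nat)
    (P : set 'rV[R]_m) (P' : set 'rV[R]_n) :
  very_ample P -> very_ample P' -> very_ample (cartesian P P').
Proof.
move=> [N N0 PN] [N' N'0 PN']; exists (maxn N N'); first by rewrite leq_max N0.
move=> k; rewrite geq_max => /andP[Nk N'k] x.
rewrite dilate_cartesian lattice_points_cartesian => -[Px P'x].
by apply/sum_of_lattice_points_cartesian; split; [exact: PN|exact: PN'].
Qed.

(** A lattice point of kP is completed by k times a lattice point of the other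
factor; projecting a decomposition of the result decomposes the given point. *)
Lemma IDP_cartesianl (R : realType) (m n : nat)
    (P : set 'rV[R]_m) (P' : set 'rV[R]_n) :
  lattice_points P' !=set0 -> IDP (cartesian P P') -> IDP P.
Proof.
move=> [y [P'y yZ]] PP' k k2 x Px.
have /PP' : lattice_points (dilate k (cartesian P P')) (row_mx x (k%:R *: y)).
  rewrite dilate_cartesian lattice_points_cartesian.
  rewrite /cartesian /= row_mxKl row_mxKr; split=> //; split; first by exists y.
  by move=> i; rewrite mxE rpredM ?rpred_nat //; exact: yZ.
by move=> /(_ k2)/sum_of_lattice_points_cartesian; rewrite row_mxKl => -[].
Qed.

(** The direction space of a product is the direct sum of the direction spaces.
It is minimal because fixing one point of a factor embeds the differences of
the other factor among those of the product. *)
Lemma has_dim_cartesian (R : realType) (m n d d' : nat)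
    (P : set 'rV[R]_m) (P' : set 'rV[R]_n) :
  has_dim P d -> has_dim P' d' -> has_dim (cartesian P P') (d + d').
Proof.
move=> [[a Pa] [U [dU PU Umin]]] [[a' P'a'] [U' [dU' PU' Umin']]].
pose fl : 'Hom('rV[R]_m, 'rV[R]_(m + n)) :=
  linfun (mulmxr (row_mx 1%:M 0 : 'M[R]_(m, m + n))).
pose fr : 'Hom('rV[R]_n, 'rV[R]_(m + n)) :=
  linfun (mulmxr (row_mx 0 1%:M : 'M[R]_(n, m + n))).
have flE y : fl y = row_mx y 0.
  by rewrite lfunE /= mul_mx_row mulmx1 mulmx0.
have frE z : fr z = row_mx 0 z.
  by rewrite lfunE /= mul_mx_row mulmx1 mulmx0.
split; first by exists (row_mx a a'); rewrite /cartesian /= row_mxKl row_mxKr.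
exists (fl @: U + fr @: U')%VS; split.
- rewrite dimv_disjoint_sum.
    rewrite !limg_dim_eq ?dU ?dU' //; apply/eqP; rewrite -subv0; apply/subvP => y;
      rewrite memv_cap memv_ker memv0 => /andP[_].
      by rewrite frE => /eqP; rewrite -row_mx0 => /eq_row_mx[_ ->].
    by rewrite flE => /eqP; rewrite -row_mx0 => /eq_row_mx[->].
  apply/eqP; rewrite -subv0; apply/subvP => y; rewrite memv_cap memv0.
  move=> /andP[/memv_imgP[z _ ->] /memv_imgP[z' _]].
  by rewrite flE frE => /eq_row_mx[-> _]; rewrite row_mx0.
- move=> x y [Px P'x] [Py P'y].
  have -> : x - y = fl (lsubmx x - lsubmx y) + fr (rsubmx x - rsubmx y).
    rewrite flE frE add_row_mx addr0 add0r -[x in LHS]hsubmxK -[y in LHS]hsubmxK.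
    by rewrite opp_row_mx add_row_mx.
  by apply: memv_add; apply: memv_img; [exact: PU|exact: PU'].
move=> W PW; rewrite subv_add; apply/andP; split.
  apply/subvP => _ /memv_imgP[y Uy ->]; rewrite memv_preim.
  apply: subvP Uy; apply: Umin => b c Pb Pc; rewrite -memv_preim.
  rewrite linearB /= !flE; set z := _ - _.
  suff -> : z = row_mx b a' - row_mx c a'.
    by apply: PW; rewrite /cartesian /= row_mxKl row_mxKr.
  by rewrite /z !opp_row_mx !add_row_mx !subrr.
apply/subvP => _ /memv_imgP[y Uy ->]; rewrite memv_preim.
apply: subvP Uy; apply: Umin' => b c Pb Pc; rewrite -memv_preim.
rewrite linearB /= !frE; set z := _ - _.
suff -> : z = row_mx a b - row_mx a c.
  by apply: PW; rewrite /cartesian /= row_mxKl row_mxKr.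
by rewrite /z !opp_row_mx !add_row_mx !subrr.
Qed.

(** * Backward differences and generating series *)

Definition backdiff (V : zmodType) (s : nat -> V) (k : nat) : V :=
  s k - (if k is k'.+1 then s k' else 0).

(** The n-fold difference at k looks back only to k - n, so the convention that
sequences vanish at negative indices is not felt from n on. *)
Lemma iter_backdiff_ext (V : zmodType) (s s' : nat -> V) m n :
  (forall k, (m <= k)%N -> s k = s' k) ->
  forall k, (m + n <= k)%N -> iter n (@backdiff V) s k = iter n (@backdiff V) s' k.
Proof.
move=> ss'; elim: n => [|n IHn] k; first by rewrite addn0; exact: ss'.
rewrite addnS; case: k => // k mnk /=; rewrite /backdiff.
by rewrite !IHn // leqW.
Qed.

(** Multiplying a power series by 1 - t takes the backward difference of its
coefficients; the sum on the left is the k-th coefficient of the product with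
the n-th power of 1 - t. *)
Lemma coef_mul_one_minus_X (K : comNzRingType) (s : nat -> K) n k :
  \sum_(i < k.+1) ((1 - 'X) ^+ n : {poly K})`_i * s (k - i)%N =
  iter n (@backdiff K) s k.
Proof.
elim: n s k => [|n IHn] s k.
  rewrite expr0 big_ord_recl coef1 mul1r subn0 big1 ?addr0 // => i _.
  by rewrite coef1 mul0r.
rewrite iterSr -IHn exprSr.
under eq_bigr do rewrite mulrBr mulr1 coefB coefMX mulrBl.
under [RHS]eq_bigr do rewrite mulrBr.
rewrite !sumrB; congr (_ - _).
rewrite big_ord_recl mul0r add0r [RHS]big_ord_recr /= subnn mulr0 addr0.
by apply: eq_bigr => i _; rewrite -(subnSK (ltn_ord i)) /= /bump add1n.
Qed.

Lemma size_backdiff_Xn (K : comNzRingType) n :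
  (size (('X^n - ('X - 1) ^+ n)%R : {poly K}) <= n)%N.
Proof.
elim: n => [|n IHn]; first by rewrite !expr0 subrr size_poly0.
have -> : 'X^(n.+1) - ('X - 1) ^+ n.+1
    = ('X^n - ('X - 1) ^+ n) * 'X + ('X - 1) ^+ n :> {poly K}.
  by rewrite !exprSr; ring.
rewrite (leq_trans (size_polyD _ _)) // geq_max -polyC1 size_exp_XsubC leqnn andbT.
rewrite (leq_trans (size_polyMleq _ _)) // size_polyX addn2 /=.
by rewrite ltnS polyC1.
Qed.

(** The degree drops because the monomials X^n and (X - 1)^n have the same
leading term. *)
Lemma size_backdiff_poly (K : comNzRingType) (p : {poly K}) n : (size p <= n.+1)%N ->
  (size (p - (p \Po ('X - 1)))%R <= n)%N.
Proof.
move=> pn.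
have -> : p - (p \Po ('X - 1)) = \sum_(i < size p) p`_i *: ('X^i - ('X - 1) ^+ i).
  rewrite -{1 2}[p]coefK poly_def raddf_sum/= -sumrB.
  by apply: eq_bigr => i _; rewrite linearZ /= comp_Xn_poly scalerBr.
apply: leq_trans (size_sum _ _ _) _; apply/bigmax_leqP => i _.
apply: leq_trans (size_scale_leq _ _) _.
by apply: leq_trans (size_backdiff_Xn K i) _; rewrite -ltnS (leq_trans (ltn_ord i)).
Qed.

Lemma iter_backdiff_poly (K : comNzRingType) (p : {poly K}) n k :
  (size p <= n)%N -> (n <= k)%N ->
  iter n (@backdiff K) (fun k => p.[k%:R]) k = 0.
Proof.
elim: n p k => [|n IHn] p k.
  by rewrite leqn0 size_poly_eq0 => /eqP-> _; rewrite /= horner0.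
move=> pn nk; rewrite iterSr -(IHn _ k (size_backdiff_poly pn) (ltnW nk)).
apply: (@iter_backdiff_ext _ _ _ 1); last by rewrite add1n.
case=> // j _; rewrite /backdiff !hornerE horner_comp !hornerE.
by rewrite -natr1 addrK.
Qed.

(** The h*-polynomial has degree at most d as soon as the Ehrhart polynomial
does, since the (d+1)-fold difference of a polynomial of degree at most d
vanishes. *)
Lemma is_hstar_ehrhart (R : realType) (n d : nat) (P : set 'rV[R]_n) E :
  has_dim P d -> is_ehrhart P E -> (size E <= d.+1)%N ->
  is_hstar P d (\poly_(k < d.+1) iter d.+1 (@backdiff rat) (fun k => E.[k%:R]) k).
Proof.
move=> Pd PE Ed; split=> //; exists E; split=> // k.
rewrite (coef_mul_one_minus_X (fun k => E.[k%:R])) coef_poly; case: ltnP => // dk.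
exact: iter_backdiff_poly.
Qed.

(** * Differences and prefix sums of lists *)

Definition backdiffs (V : zmodType) (s : seq V) : seq V :=
  pairmap (fun a b => b - a) 0 s.

Lemma backdiffs_mkseq (V : zmodType) (s : nat -> V) n :
  backdiffs (mkseq s n) = mkseq (backdiff s) n.
Proof.
apply: (@eq_from_nth _ 0); first by rewrite size_pairmap !size_mkseq.
move=> i; rewrite size_pairmap size_mkseq => ilt.
rewrite (nth_pairmap 0) ?size_mkseq // !nth_mkseq //.
by rewrite /backdiff; case: i ilt => //= i /ltnW ilt; rewrite nth_mkseq.
Qed.

Lemma iter_backdiffs_mkseq (V : zmodType) (s : nat -> V) m n :
  iter m (@backdiffs V) (mkseq s n) = mkseq (iter m (@backdiff V) s) n.
Proof. by elim: m => //= m ->; rewrite backdiffs_mkseq. Qed.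

Definition prefix_sums (V : nmodType) (s : seq V) : seq V := scanl +%R 0 s.

(** Iterated prefix sums of the constant sequence 1 produce the binomials
C(k+m,m) with additions only, which makes their values computable in binary
arithmetic. *)
Lemma prefix_sums_binomial m n :
  iter m (@prefix_sums Z) (nseq n 1) = mkseq (fun k => 'C(k + m, m)%:R) n.
Proof.
elim: m => [|m IHm] /=.
  apply: (@eq_from_nth _ 0); rewrite ?size_mkseq ?size_nseq // => i ilt.
  by rewrite nth_nseq ilt nth_mkseq // addn0 bin0.
rewrite IHm; apply: (@eq_from_nth _ 0); first by rewrite size_scanl !size_mkseq.
move=> i; rewrite size_scanl size_mkseq => ilt.
rewrite (nth_scanl 0) ?size_mkseq // nth_mkseq //.
elim: i ilt => [|i IHi] ilt.
  by case: n ilt {IHm} => //= n _; rewrite add0r !add0n !binn take0.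
rewrite (take_nth 0) ?size_mkseq // foldl_rcons IHi ?nth_mkseq //; last exact: ltnW.
by rewrite -natrD [(i.+1 + m.+1)%N]addSn binS addSnnS.
Qed.

(** * The Ehrhart polynomial of Q and the dip in the h*-vector *)

(** The polynomial k |-> C(k+c,m). *)
Definition bin_poly (m c : nat) : {poly rat} :=
  (m`!%:R)^-1 *: \prod_(i < m) ('X + (c%:R - i%:R)%:P).

(** For n < m both sides vanish: the left one has the factor n - n. *)
Lemma natr_ffact (R : comNzRingType) (n m : nat) :
  \prod_(i < m) (n%:R - i%:R) = (n ^_ m)%:R :> R.
Proof.
elim: m => [|m IHm]; first by rewrite big_ord0.
rewrite big_ord_recr /= IHm ffactnSr natrM.
have [mn|nm] := leqP m n; first by rewrite natrB.
by rewrite ffact_small // !mul0r.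
Qed.

Lemma horner_bin_poly m c k : (bin_poly m c).[k%:R] = 'C(k + c, m)%:R.
Proof.
rewrite hornerZ horner_prod.
under eq_bigr do rewrite hornerD hornerX hornerC addrA -natrD.
rewrite natr_ffact -bin_ffact natrM mulrC mulfK //.
by rewrite pnatr_eq0 -lt0n fact_gt0.
Qed.

Lemma size_bin_poly m c : (size (bin_poly m c) <= m.+1)%N.
Proof.
apply: leq_trans (size_scale_leq _ _) _.
rewrite size_prod => [|i _]; last by rewrite -size_poly_eq0 size_XaddC.
under eq_bigr do rewrite size_XaddC.
by rewrite sum_nat_const card_ord; lia.
Qed.

(** Iterated Pascal rule: the leading terms of the two binomials cancel, which is
why E_Q has degree 29 although its first summand looks like it has degree 30. *)
Lemma bin_telescope a m n :
  'C(a + n, m.+1) = ('C(a, m.+1) + \sum_(j < n) 'C(a + j, m))%N.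
Proof.
elim: n => [|n IHn]; first by rewrite big_ord0 !addn0.
by rewrite addnS binS IHn big_ord_recr /= addnA.
Qed.

(** The number of lattice points of kQ. *)
Definition countQ (k : nat) : nat :=
  k.+1 * ('C(k + 29, 29) - 'C(k + 14, 29)) + 332 * 'C(k + 14, 29).

(** The same count, with the difference of binomials expanded by
[bin_telescope] so that the degree is visible. *)
Definition ehrhartQ : {poly rat} :=
  ('X + 1%:P) * (\sum_(j < 15) bin_poly 28 (14 + j)) + 332%:R *: bin_poly 29 14.

Lemma horner_ehrhartQ k : ehrhartQ.[k%:R] = (countQ k)%:R.
Proof.
rewrite /ehrhartQ hornerD hornerM hornerZ hornerD
  hornerX hornerC horner_bin_poly horner_sum.
under eq_bigr do rewrite horner_bin_poly.
have E : ('C(k + 29, 29) - 'C(k + 14, 29) = \sum_(j < 15) 'C(k + (14 + j), 28))%N.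
  have -> : (k + 29 = k + 14 + 15)%N by rewrite -addnA.
  rewrite (bin_telescope (k + 14) 28 15).
  by rewrite addKn; apply: eq_bigr => j _; rewrite addnA.
by rewrite /countQ E natrD !natrM -[k.+1%:R]natr1 natr_sum.
Qed.

Lemma size_ehrhartQ : (size ehrhartQ <= 30)%N.
Proof.
rewrite (leq_trans (size_polyD _ _)) // geq_max.
rewrite (leq_trans (size_scale_leq _ _) (size_bin_poly _ _)) andbT.
rewrite (leq_trans (size_polyMleq _ _)) // size_XaddC add2n /= ltnS.
by apply: leq_trans (size_sum _ _ _) _; apply/bigmax_leqP => i _; exact: size_bin_poly.
Qed.

Lemma size_ehrhartQQ : (size (ehrhartQ ^+ 2) <= 59)%N.
Proof.
rewrite (leq_trans (size_poly_exp_leq _ _)) // ltnS.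
by have := size_ehrhartQ; lia.
Qed.

(** The values of E_Q^2 at 0, ..., 27 in a form that evaluates quickly. Since
C(k+14,29) vanishes for k < 15, its list is the list of C(k+29,29) delayed by
15 places. *)
Definition countQQ_seq : seq Z :=
  let b := iter 29 (@prefix_sums Z) (nseq 28 1) in
  let c := nseq 15 0 ++ b in
  mkseq (fun k => (k.+1%:R * (b`_k - c`_k) + 332%:R * c`_k) ^+ 2) 28.

Lemma countQQ_seqE : countQQ_seq = mkseq (fun k => (countQ k ^ 2)%:R) 28.
Proof.
rewrite /countQQ_seq prefix_sums_binomial; apply/eq_in_map => k.
rewrite mem_iota => /andP[_ k28].
rewrite nth_cat size_nseq (nth_mkseq _ _ k28).
have -> : (if (k < 15)%N then (nseq 15 0)`_k
    else (mkseq (fun k => 'C(k + 29, 29)%:R) 28)`_(k - 15)) = 'C(k + 14, 29)%:R :> Z.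
  case: ltnP => k15; first by rewrite nth_nseq k15 bin_small //; lia.
  rewrite nth_mkseq; last by lia.
  by congr ('C(_, _)%:R); lia.
rewrite natrX natrD !natrM natrB //.
by apply: leq_bin2l; rewrite leq_add2l.
Qed.

Definition ratZ (z : Z) : rat := (int_of_Z z)%:~R.

Lemma ltr_ratZ x y : (ratZ x < ratZ y) = (x < y).
Proof.
have ZE z : z = (int_of_Z z)%:~R.
  by rewrite -[LHS]int_of_ZK -[int_of_Z z in LHS]intz rmorph_int.
by rewrite /ratZ ltr_int [x in RHS]ZE [y in RHS]ZE ltr_int.
Qed.

Lemma iter_backdiff_ratZ (s : nat -> Z) n k :
  iter n (@backdiff rat) (ratZ \o s) k = ratZ (iter n (@backdiff Z) s k).
Proof.
elim: n k => //= n IHn k; rewrite /backdiff IHn.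
by case: k => [|k]; rewrite ?IHn /ratZ ?raddf0 ?subr0 // raddfB rmorphB.
Qed.

Definition hstarQQ : {poly rat} :=
  \poly_(k < 59) iter 59 (@backdiff rat) (fun k => (ehrhartQ ^+ 2).[k%:R]) k.

Lemma coef_hstarQQ k : (k < 28)%N ->
  hstarQQ`_k = ratZ (iter 59 (@backdiffs Z) countQQ_seq)`_k.
Proof.
move=> k28; rewrite coef_poly ifT; last exact: leq_trans k28 _.
rewrite countQQ_seqE iter_backdiffs_mkseq nth_mkseq // -iter_backdiff_ratZ.
have -> // : (fun k => (ehrhartQ ^+ 2).[k%:R]) = ratZ \o fun k => (countQ k ^ 2)%:R.
by apply/funext => j /=; rewrite horner_exp horner_ehrhartQ /ratZ !rmorph_nat natrX.
Qed.

Lemma hstarQQ_lt i j : (i < 28)%N -> (j < 28)%N ->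
  (iter 59 (@backdiffs Z) countQQ_seq)`_i < (iter 59 (@backdiffs Z) countQQ_seq)`_j ->
  hstarQQ`_i < hstarQQ`_j.
Proof.
move=> i28 j28 ij; rewrite (coef_hstarQQ i28) (coef_hstarQQ j28).
by rewrite ltr_ratZ.
Qed.

(** Evaluation of three coefficients. They come from the values of E_Q^2 at
0, ..., 27 only, since differences look backwards. *)
Lemma hstarQQ_dip : hstarQQ`_26 < hstarQQ`_25 /\ hstarQQ`_26 < hstarQQ`_27.
Proof.
split.
  by apply: (@hstarQQ_lt 26 25 isT isT); vm_compute.
by apply: (@hstarQQ_lt 26 27 isT isT); vm_compute.
Qed.

(** * Edge coordinates for points of kQ *)

(** The 60 generators of Q, indexed by an edge and by which end of the vertical
segment above it is taken. *)
Definition genQ (R : realType) (ib : 'I_30 * bool) : 'rV[R]_(30 + 1) :=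
  row_mx (u R ib.1) (332 * (ib.1 == ord0)%:R + ib.2%:R)%:M.

Lemma Q_conv (R : realType) : Q R = conv (range (genQ R)).
Proof.
have genE i b : genQ R (i, b) = row_mx (u R i) (332 * (i == ord0)%:R + b%:R)%:M by [].
congr conv; apply/seteqP; split=> x.
  case=> [[->|->]|[i /negPf i0 [->|->]]].
  - by exists (ord0, false); rewrite // genE eqxx mulr1 addr0.
  - by exists (ord0, true); rewrite // genE eqxx mulr1 natr1.
  - by exists (i, false); rewrite // genE i0 mulr0 addr0.
  - by exists (i, true); rewrite // genE i0 mulr0 add0r.
move=> [[i b] _ <-]; rewrite genE.
have [->|i0] := eqVneq i ord0; rewrite ?mulr1 ?mulr0.
  by left; case: b; [right; rewrite natr1|left; rewrite addr0].
by right; exists i => //; case: b; [right|left]; rewrite add0r.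
Qed.

(** The point of height z over the base point with (nonunique) edge coordinates
l. *)
Definition comb (R : realType) (l : 'I_30 -> R) (z : R) : 'rV[R]_(30 + 1) :=
  row_mx (\sum_i l i *: u R i) z%:M.

Lemma comb_height (R : realType) (l : 'I_30 -> R) z :
  comb l z 0 (rshift 30 0) = z.
Proof. by rewrite row_mxEr mxE eqxx mulr1n. Qed.

Lemma comb_coord (R : realType) (l : 'I_30 -> R) z i :
  comb l z 0 (lshift 1 (ordS i)) = l (ordS i) + l i.
Proof.
rewrite row_mxEl summxE.
under eq_bigr do rewrite !mxE /= mulrDr.
rewrite big_split /= (bigD1 (ordS i)) //= eqxx mulr1 big1 ?addr0.
  rewrite (bigD1 i) //= eqxx mulr1 big1 ?addr0 // => j ji.
  by rewrite (can_eq (@ordSK _)) eq_sym (negPf ji) mulr0.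
by move=> j ji; rewrite eq_sym (negPf ji) mulr0.
Qed.

(** The height above 332 l_1 is the total weight put on upper ends, hence lies
between 0 and k; conversely any such height is reached by splitting the weight
of all edges in the same proportion. *)
Lemma dilateQ (R : realType) k x : (0 < k)%N ->
  dilate k (Q R) x <-> exists (l : 'I_30 -> R) (z : R),
    [/\ forall i, 0 <= l i, \sum_i l i = k%:R,
        332 * l ord0 <= z <= 332 * l ord0 + k%:R & x = comb l z].
Proof.
move=> k0; have pairE (V : nmodType) (F : 'I_30 * bool -> V) :
    \sum_ib F ib = \sum_i (F (i, true) + F (i, false)).
  rewrite [LHS](eq_bigr (fun ib => F (ib.1, ib.2))); last by case.
  rewrite -(pair_bigA _ (fun i b => F (i, b))) /=.
  by apply: eq_bigr => i _; rewrite big_bool.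
rewrite Q_conv dilate_conv_range //; split=> [[w [w0 w1 ->]]|].
  exists (fun i => w (i, true) + w (i, false)).
  exists (332 * (w (ord0, true) + w (ord0, false)) + \sum_i w (i, true)).
  split.
  - by move=> i; rewrite addr_ge0.
  - by rewrite -w1 pairE.
  - rewrite lerDl lerD2l sumr_ge0 //= -w1 pairE.
    by apply: ler_sum => i _; rewrite lerDl.
  under eq_bigr do rewrite scale_row_mx scale_scalar_mx.
  rewrite (row_mx_sum xpredT) -raddf_sum !pairE /comb; congr (row_mx _ (_ %:M)).
    by apply: eq_bigr => i _; rewrite scalerDl.
  have -> : \sum_i w (i, true) = \sum_i (w (i, true) * 1 + w (i, false) * 0).
    by apply: eq_bigr => i _; rewrite mulr1 mulr0 addr0.
  have -> : 332 * (w (ord0, true) + w (ord0, false)) =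
      \sum_i (w (i, true) + w (i, false)) * (332 * (i == ord0)%:R).
    rewrite (bigD1 ord0) //= mulr1 mulrC big1 ?addr0 // => i /negPf->.
    by rewrite !mulr0.
  rewrite -big_split /=; apply: eq_bigr => i _.
  rewrite -[true%:R]/1 -[false%:R]/0; move: (332 * _) => c; ring.
move=> [l [z [l0 lk /andP[zl zu] ->]]].
have kR : 0 < k%:R :> R by rewrite ltr0n.
pose t := (z - 332 * l ord0) / k%:R.
have t0 : 0 <= t by rewrite divr_ge0 // subr_ge0.
have t1 : t <= 1 by rewrite ler_pdivrMr // mul1r lerBlDl.
exists (fun ib => (if ib.2 then t else 1 - t) * l ib.1); split.
- by move=> [i []] /=; rewrite mulr_ge0 // subr_ge0.
- by rewrite pairE -lk; apply: eq_bigr => i _ /=; rewrite -mulrDl addrC subrK mul1r.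
under eq_bigr do rewrite scale_row_mx scale_scalar_mx.
rewrite (row_mx_sum xpredT) -raddf_sum !pairE /comb /=; congr (row_mx _ (_ %:M)).
  by apply: eq_bigr => i _; rewrite -scalerDl -mulrDl addrC subrK mul1r.
transitivity (\sum_i (l i * (332 * (i == ord0)%:R) + t * l i)).
  rewrite big_split /= -mulr_sumr lk divfK ?lt0r_neq0 //.
  have -> : \sum_i l i * (332 * (i == ord0)%:R) = 332 * l ord0.
    rewrite (bigD1 ord0) //= big1 ?addr0 => [|i /negPf->]; last by rewrite !mulr0.
    by rewrite mulr1n mulr1 mulrC.
  by rewrite addrC subrK.
apply: eq_bigr => i _; move: (332 * _) => c.
by rewrite -[true%:R]/1 -[false%:R]/0; ring.
Qed.

(** Walking once around the cycle. *)
Lemma ordS_ind (P : 'I_30 -> Prop) :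
  P ord0 -> (forall i, P i -> P (ordS i)) -> forall i, P i.
Proof.
move=> P0 PS [m]; elim: m => [|m IHm] m30.
  by rewrite (_ : Ordinal _ = ord0) //; exact: val_inj.
rewrite (_ : Ordinal _ = ordS (Ordinal (ltnW m30))); first exact/PS/IHm.
by apply: val_inj; rewrite /= modn_small.
Qed.

Definition altsign (R : numDomainType) (i : 'I_30) : R := (-1) ^+ i.

Lemma altsign0 (R : numDomainType) : altsign R ord0 = 1. Proof. by []. Qed.

Lemma odd_ordS (i : 'I_30) : odd (ordS i) = ~~ odd i.
Proof. by rewrite /= odd_mod. Qed.

Lemma altsignE (R : numDomainType) i : altsign R i = if odd i then -1 else 1.
Proof. by rewrite /altsign -signr_odd; case: odd. Qed.

Lemma altsign_ordS (R : numDomainType) i : altsign R (ordS i) = - altsign R i.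
Proof. by rewrite !altsignE odd_ordS; case: odd; rewrite ?opprK. Qed.

Lemma sum_ordS (V : nmodType) (f : 'I_30 -> V) : \sum_i f (ordS i) = \sum_i f i.
Proof.
by rewrite [RHS](reindex (@ordS 30)) //; exists (@ord_pred 30) => i _;
  [exact: ordSK|exact: ord_predK].
Qed.

(** Rotating the cycle by one step changes the sign of the sum. *)
Lemma sum_altsign (R : numDomainType) : \sum_i altsign R i = 0.
Proof.
have : \sum_i altsign R i = - \sum_i altsign R i.
  by rewrite -[LHS]sum_ordS -sumrN; apply: eq_bigr => i _; exact: altsign_ordS.
by move=> /eqP; rewrite -addr_eq0 -mulr2n mulrn_eq0 => /eqP.
Qed.

(** Integrality of the base point says that consecutive edge coordinates sum to
integers; then all of them are determined modulo integers by the first. *)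
Lemma alternating_int (R : realType) (f : 'I_30 -> R) :
  (forall i, f (ordS i) + f i \is a Num.int) ->
  forall i, f i - altsign R i * f ord0 \is a Num.int.
Proof.
move=> fS; elim/ordS_ind => [|i fi]; first by rewrite altsign0 mul1r subrr rpred0.
rewrite altsign_ordS mulNr opprK.
have -> : f (ordS i) + altsign R i * f ord0 =
    (f (ordS i) + f i) - (f i - altsign R i * f ord0) by ring.
by rewrite rpredB.
Qed.

(** The kernel of the map from edge coordinates to base points is the line
spanned by the alternating vector. *)
Lemma alternating0 (R : numDomainType) (f : 'I_30 -> R) :
  (forall i, f (ordS i) + f i = 0) -> forall i, f i = altsign R i * f ord0.
Proof.
move=> f0; elim/ordS_ind => [|i fi]; first by rewrite altsign0 mul1r.
by rewrite altsign_ordS mulNr -fi; apply/eqP; rewrite -addr_eq0 f0.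
Qed.

Lemma comb_eq (R : realType) (l l' : 'I_30 -> R) z z' :
  comb l z = comb l' z' -> z = z' /\ exists c, forall i, l i = l' i + altsign R i * c.
Proof.
move=> E; split; first by rewrite -(comb_height l z) E comb_height.
exists (l ord0 - l' ord0) => i.
have d0 j : (l (ordS j) - l' (ordS j)) + (l j - l' j) = 0.
  have := congr1 (fun x : 'rV[R]_(30 + 1) => x 0 (lshift 1 (ordS j))) E.
  rewrite (comb_coord l) (comb_coord l') => Ej.
  by rewrite addrACA Ej -opprD subrr.
by have /= <- := @alternating0 _ (fun j => l j - l' j) d0 i; rewrite addrC subrK.
Qed.

Lemma comb_altsign (R : realType) (l : 'I_30 -> R) c z :
  comb (fun i => l i + altsign R i * c) z = comb l z.
Proof.
rewrite /comb; congr row_mx; apply/rowP => j.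
have E i m : (\sum_i m i *: u R i) 0 i = comb m 0 0 (lshift 1 i) by rewrite row_mxEl.
by rewrite !E -[j]ord_predK !comb_coord altsign_ordS; ring.
Qed.

(** * Normal form of the lattice points of kQ *)

Definition lattice_pt (R : realType) (n : 'I_30 -> nat) (r : nat) : 'rV[R]_(30 + 1) :=
  comb (fun i => (n i)%:R) (332 * (n ord0)%:R + r%:R).

(** This is the condition for n plus the alternating vector to be nonnegative
again. *)
Definition oddpos (n : 'I_30 -> nat) := [forall i : 'I_30, odd i ==> (0 < n i)%N].

(** How many heights, starting from 332 n_1, are credited to the representation
n: up to the start of the window of the next representation when there is one,
and otherwise the whole window of length k. *)
Definition fibre k n := if oddpos n then 332%N else k.+1.

(** The next representation of the same base point, n plus the alternating
vector. *)
Definition slide (n : 'I_30 -> nat) (i : 'I_30) : nat :=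
  if odd i then (n i).-1 else (n i).+1.

Lemma slideE (R : numDomainType) n i : oddpos n ->
  (slide n i)%:R = (n i)%:R + altsign R i * 1.
Proof.
move=> /forallP/(_ i); rewrite /slide altsignE; case: odd => /= [|_].
  by case: (n i) => //= m _; rewrite -natr1; ring.
by rewrite -natr1 mul1r.
Qed.

Lemma sum_slide n : oddpos n -> (\sum_i slide n i = \sum_i n i)%N.
Proof.
move=> np; apply/eqP; rewrite -(eqr_nat rat) !natr_sum.
under eq_bigr do rewrite (slideE _ _ np).
by rewrite big_split /= -mulr_suml sum_altsign mul0r addr0.
Qed.

Lemma lattice_pt_slide (R : realType) n r : oddpos n ->
  lattice_pt R (slide n) r = lattice_pt R n (r + 332).
Proof.
move=> np; rewrite /lattice_pt.
transitivity (comb (fun i => (n i)%:R + altsign R i * 1)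
  (332 * (n ord0)%:R + (r + 332)%N%:R)).
  rewrite /comb; congr (row_mx _ _%:M); first by apply: eq_bigr => i _; rewrite slideE.
  by rewrite slideE // altsign0 natrD; ring.
by rewrite comb_altsign.
Qed.

(** Moving to the next representation lowers the offset r by 332; this stops in
the credited range. The second alternative of the hypothesis covers the heights
in the hole between two consecutive windows and in the upper one of them. *)
Lemma lattice_pt_normal (R : realType) k n r : (\sum_i n i = k)%N ->
  (r <= k)%N || oddpos n && (r <= k + 332)%N ->
  exists n' r', [/\ (\sum_i n' i = k)%N, (r' < fibre k n')%N &
    lattice_pt R n r = lattice_pt R n' r'].
Proof.
have [m] := ubnP r; elim: m => // m IHm in n r *; rewrite ltnS => rm nk rk.
have [rf|] := ltnP r (fibre k n); first by exists n, r.
rewrite /fibre; case: ifP rk => np /= rk; last by rewrite orbF in rk; lia.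
move=> r332; have [|||n' [r' [n'k r'f E]]] := IHm (slide n) (r - 332)%N.
- lia.
- by rewrite sum_slide.
- by apply/orP; left; lia.
- by exists n', r'; rewrite -E lattice_pt_slide // subnK.
Qed.

(** Each coordinate of a base point is the sum of two consecutive edge
coordinates. *)
Lemma comb_lattice (R : realType) (l : 'I_30 -> R) z :
  lattice R (30 + 1) (comb l z) <->
  (forall i, l (ordS i) + l i \is a Num.int) /\ z \is a Num.int.
Proof.
split=> [lat|[lZ zZ] j].
  by split=> [i|]; [rewrite -(comb_coord l z)|rewrite -(comb_height l z)]; exact: lat.
rewrite -[j]splitK; case: (fintype.split j) => i /=; last by rewrite ord1 comb_height.
by rewrite -[i]ord_predK comb_coord.
Qed.

(** Given real edge coordinates l of a lattice point, let e be the fractional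
part of l_1. Subtracting e times the alternating vector makes l integral and
keeps it nonnegative, and it lowers the window of heights by 332 e. If e > 0
the result can be moved up again, which is what admits the heights beyond k.
Conversely a height 332 n_1 + r in a hole is reached by moving from n towards
the next representation by the fraction r/332. *)
Lemma lattice_points_dilateQ (R : realType) k x : (0 < k)%N ->
  lattice_points (dilate k (Q R)) x <->
  exists n r, [/\ (\sum_i n i = k)%N, (r < fibre k n)%N & x = lattice_pt R n r].
Proof.
move=> k0; split.
  move=> [/(dilateQ _ k0)[l [z [l0 lk /andP[zl zu] ->]]] /comb_lattice[lZ zZ]].
  pose e := l ord0 - (Num.floor (l ord0))%:~R.
  have e0 : 0 <= e by rewrite subr_ge0 floor_le.
  have e1 : e < 1 by rewrite ltrBlDl -intrD1 floorD1_gt.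
  pose n i := Num.truncn (l i - altsign R i * e).
  have nE i : (n i)%:R = l i - altsign R i * e.
    have xZ : l i - altsign R i * e \is a Num.int.
      have -> : l i - altsign R i * e =
        (l i - altsign R i * l ord0) + altsign R i * (Num.floor (l ord0))%:~R.
        by rewrite /e; ring.
      rewrite rpredD ?alternating_int // rpredM ?intr_int //.
      by rewrite altsignE; case: odd; rewrite ?rpredN rpred1.
    apply/eqP; rewrite -natrEtruncn natrEint xZ /=.
    have [m mE] := intrP xZ; rewrite mE ler0z.
    (* an integer above -1 is nonnegative; this covers even and odd i alike *)
    suff : (- 1)%:~R < m%:~R :> R by rewrite ltr_int; lia.
    rewrite -mE rmorphN1; move: (l0 i); rewrite altsignE; case: odd => li; lra.
  have l0E : l ord0 = (n ord0)%:R + e by rewrite nE altsign0 mul1r subrK.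
  pose r := Num.truncn (z - 332 * (n ord0)%:R).
  have rE : r%:R = z - 332 * (n ord0)%:R.
    apply/eqP; rewrite -natrEtruncn natrEint; apply/andP; split.
      by rewrite rpredB // rpredM // rpred_nat.
    rewrite subr_ge0 (le_trans _ zl) // ler_wpM2l //.
    by rewrite l0E lerDl.
  have -> : comb l z = lattice_pt R n r.
    rewrite /lattice_pt rE (addrC _ (z - _)) subrK -[RHS](comb_altsign _ e); congr comb.
    by apply/funext => i; rewrite nE subrK.
  have nk : (\sum_i n i = k)%N.
    apply/eqP; rewrite -(eqr_nat R) natr_sum -lk.
    under eq_bigr do rewrite nE.
    by rewrite sumrB -mulr_suml sum_altsign mul0r subr0.
  have [|n' [r' [n'k r'f E]]] := @lattice_pt_normal R k n r nk; last by exists n', r'.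
  have ru : r%:R <= 332 * e + k%:R.
    by rewrite rE lerBlDl addrA -mulrDr -l0E.
  have [e00|epos] := eqVneq e 0.
    by apply/orP; left; rewrite -(ler_nat R) (le_trans ru) // e00 mulr0 add0r.
  apply/orP; right; apply/andP; split.
    apply/forallP => i; apply/implyP => oi; rewrite -(ltr_nat R) nE altsignE oi.
    by rewrite mulN1r opprK ltr_wpDl // lt_def epos.
  rewrite -(ler_nat R) natrD (le_trans ru) // addrC lerD2l.
  by rewrite ler_piMr // ltW.
move=> [n [r [nk rf ->]]].
have natZ (m : nat) : m%:R \is a @Num.int R by rewrite rpred_nat.
split; last by apply/comb_lattice; split=> [i|]; rewrite rpredD ?rpredM.
apply/(dilateQ _ k0).
pose t : R := if oddpos n then r%:R / 332 else 0.
exists (fun i => (n i)%:R + altsign R i * t).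
exists (332 * (n ord0)%:R + r%:R); split; last by rewrite /lattice_pt comb_altsign.
- move=> i; have t0 : 0 <= t by rewrite /t; case: ifP => // _; rewrite divr_ge0.
  rewrite altsignE; case: ifP => oi; last by rewrite mul1r addr_ge0.
  rewrite mulN1r subr_ge0 /t; case: ifP => [np|_]; last by rewrite ler0n.
  move: rf; rewrite /fibre np => rf.
  have ni : (0 < n i)%N by have /forallP/(_ i) := np; rewrite oi.
  apply: (@le_trans _ _ 1); last by rewrite ler1n.
  by rewrite ler_pdivrMr // mul1r ler_nat ltnW.
- by rewrite big_split /= -mulr_suml sum_altsign mul0r addr0 -nk natr_sum.
rewrite altsign0 mul1r /t; move: rf; rewrite /fibre; case: ifP => _ rf.
  by rewrite mulrDr (mulrC _ (_ / _)) divfK ?pnatr_eq0 // lexx lerDl ler0n.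
by rewrite addr0 lerDl ler0n lerD2l ler_nat -ltnS.
Qed.

(** If two representations of a base point differ, the one with smaller first
coordinate can be moved up, so its heights stop before 332 (n_1 + 1), where
those of the other one begin. *)
Lemma lattice_pt_inj (R : realType) k n n' r r' :
  (r < fibre k n)%N -> (r' < fibre k n')%N ->
  lattice_pt R n r = lattice_pt R n' r' -> n = n' /\ r = r'.
Proof.
wlog le0 : n n' r r' / (n ord0 <= n' ord0)%N => [H rf r'f E|].
  have [/H|/ltnW/H] := leqP (n ord0) (n' ord0); first exact.
  by move=> /(_ r' r r'f rf (esym E))[-> ->].
move=> rf _ /comb_eq[hE [c nE]].
have cE : c = (n ord0)%:R - (n' ord0)%:R by rewrite nE altsign0; ring.
have {}hE : (332 * n ord0 + r = 332 * n' ord0 + r')%N.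
  by apply/eqP; rewrite -(eqr_nat R) (natrD _ (332 * n ord0)) (natrD _ (332 * n' ord0))
      (natrM _ 332 (n ord0)) (natrM _ 332 (n' ord0)) hE.
have [n0|] := eqVneq (n ord0) (n' ord0).
  have nn' : n = n'.
    apply/funext => i; apply/eqP.
    by rewrite -(eqr_nat R) nE cE n0 subrr mulr0 addr0.
  by split=> //; move: hE; rewrite n0 => /addnI.
move=> ne0; have lt0 : (n ord0 < n' ord0)%N by rewrite ltn_neqAle ne0.
have np : oddpos n.
  apply/forallP => i; apply/implyP => oi; rewrite -(ltr_nat R) nE altsignE oi cE.
  rewrite mulN1r opprB ltr_wpDl // subr_gt0 ltr_nat.
  by [].
by move: rf; rewrite /fibre np; lia.
Qed.

(** * Counting lattice points *)

(** Vectors of natural numbers of sum k have entries at most k, so they are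
counted as tuples over a finite type. *)
Definition entries k (t : 30.-tuple 'I_k.+1) (i : 'I_30) : nat := tnth t i.

Definition tuple_of k (f : 'I_30 -> nat) : 30.-tuple 'I_k.+1 :=
  [tuple inord (f i) | i < 30].

Lemma entries_inj k : injective (@entries k).
Proof.
move=> t t' E; apply: eq_from_tnth => i; apply: val_inj.
exact: (congr1 (fun f => f i) E).
Qed.

Lemma tuple_ofK k (f : 'I_30 -> nat) :
  (forall i, f i <= k)%N -> entries (tuple_of k f) = f.
Proof. by move=> fk; apply/funext => i; rewrite /entries tnth_mktuple inordK ?ltnS. Qed.

Definition compositions k : {set 30.-tuple 'I_k.+1} :=
  [set t | (\sum_i entries t i == k)%N]%SET.

Lemma card_compositions k : #|compositions k| = 'C(k + 29, 29).
Proof.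
rewrite addnC -(card_ord_partitions 29 k); apply: eq_card => t.
by rewrite !inE big_tuple.
Qed.

Lemma leq_sum_entry (f : 'I_30 -> nat) i : (f i <= \sum_j f j)%N.
Proof. by rewrite (bigD1 i) //= leq_addr. Qed.

Lemma sum_odd : (\sum_(i < 30) odd i = 15)%N.
Proof. by rewrite -(big_mkord xpredT (fun i => odd i : nat)) unlock. Qed.

(** Subtracting 1 from each of the 15 odd-indexed entries is a bijection onto the
vectors of sum k - 15. *)
Lemma card_oddpos_compositions k :
  #|[set t in compositions k | oddpos (entries t)]%SET| = 'C(k + 14, 29).
Proof.
have [k15|k15] := ltnP k 15.
  rewrite bin_small; last by lia.
  apply/eqP; rewrite cards_eq0; apply/eqP/setP => t; rewrite !inE.
  apply: contraTF k15 => /andP[/eqP tk /forallP tp].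
  rewrite -leqNgt -sum_odd -[X in (_ <= X)%N]tk.
  by apply: leq_sum => i _; have := tp i; case: odd.
have -> : (k + 14 = k - 15 + 29)%N by lia.
rewrite -card_compositions.
pose h (t : 30.-tuple 'I_(k - 15).+1) := tuple_of k (fun i => entries t i + odd i)%N.
have hE t : entries (h t) = (fun i => entries t i + odd i)%N.
  apply: tuple_ofK => i; have := ltn_ord (tnth t i); rewrite /entries.
  by case: odd; lia.
rewrite -(card_imset (f := h)); last first.
  move=> t t' /(congr1 (@entries k)); rewrite !hE => E; apply/entries_inj/funext => i.
  by move: (congr1 (fun f => f i) E) => /addIn.
apply: eq_card => t; rewrite !inE; apply/andP/imsetP => [[/eqP tk /forallP tp]|[s]].
  have odd_le (i : 'I_30) : (odd i <= entries t i)%N by have := tp i; case: odd.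
  have sk : (\sum_i (entries t i - odd i) = k - 15)%N.
    by rewrite sumnB // tk sum_odd.
  pose s := tuple_of (k - 15) (fun i => entries t i - odd i)%N.
  have sE : entries s = (fun i => entries t i - odd i)%N.
    apply: tuple_ofK => i.
    by rewrite -sk (leq_sum_entry (fun i => entries t i - odd i)%N).
  exists s; first by rewrite inE sE sk.
  by apply: entries_inj; rewrite hE sE; apply/funext => i; rewrite subnK.
rewrite inE => /eqP sk ->; rewrite hE; split.
  by rewrite big_split /= sum_odd sk subnK.
by apply/forallP => i; apply/implyP => ->; rewrite addn1.
Qed.

(** Names for the lattice points of kQ. The bound k + 333 exceeds every credited
range, so it only makes the type finite. *)
Definition codes k : {set 30.-tuple 'I_k.+1 * 'I_(k + 333)} :=
  [set p : 30.-tuple 'I_k.+1 * 'I_(k + 333) |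
     (p.1 \in compositions k) && ((p.2 : nat) < fibre k (entries p.1))%N]%SET.

Lemma card_codes k : #|codes k| = countQ k.
Proof.
rewrite -sum1_card (eq_bigl (fun p : 30.-tuple 'I_k.+1 * 'I_(k + 333) =>
  (p.1 \in compositions k) && (p.2 < fibre k (entries p.1))%N)); last first.
  by move=> p; rewrite inE.
rewrite -(pair_big_dep (fun t => t \in compositions k)
  (fun t (r : 'I_(k + 333)) => r < fibre k (entries t))%N (fun _ _ => 1%N)) /=.
have fibreE t : (\sum_(r < k + 333 | r < fibre k (entries t)) 1 = fibre k (entries t))%N.
  rewrite -(big_ord_widen (k + 333) (fun=> 1%N)).
    by rewrite sum1_card card_ord.
  by rewrite /fibre; case: ifP => _; lia.
under eq_bigr do rewrite fibreE.
rewrite (bigID (fun t => oddpos (entries t))) /=.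
rewrite (eq_bigr (fun=> 332)); last by rewrite /fibre => t /andP[_ ->].
rewrite [X in (_ + X)%N](eq_bigr (fun=> k.+1)); last first.
  by rewrite /fibre => t /andP[_ /negPf->].
rewrite !sum_nat_cond_const.
have EB := card_oddpos_compositions k.
have := cardsID [set t | oddpos (entries t)]%SET (compositions k).
rewrite card_compositions.
have -> : compositions k :&: [set t | oddpos (entries t)]%SET =
   [set t in compositions k | oddpos (entries t)]%SET by apply/setP => t; rewrite !inE.
have -> : compositions k :\: [set t | oddpos (entries t)]%SET =
   [set t in compositions k | ~~ oddpos (entries t)]%SET.
  by apply/setP => t; rewrite !inE andbC.
rewrite EB /countQ => <-; rewrite addKn addnC; congr (_ + _)%N; rewrite mulnC //.
Qed.

Definition decode (R : realType) k (p : 30.-tuple 'I_k.+1 * 'I_(k + 333)) :=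
  lattice_pt R (entries p.1) p.2.

Lemma decode_inj (R : realType) k : {in codes k &, injective (@decode R k)}.
Proof.
move=> [t r] [t' r']; rewrite !inE /= => /andP[_ rf] /andP[_ r'f].
by move=> /(lattice_pt_inj rf r'f)[/entries_inj -> /val_inj ->].
Qed.

Lemma lattice_points_dilateQ_decode (R : realType) k : (0 < k)%N ->
  lattice_points (dilate k (Q R)) = @decode R k @` [set` codes k].
Proof.
move=> k0; apply/seteqP; split=> x.
  move=> /(lattice_points_dilateQ _ k0)[n [r [nk rf ->]]].
  have nE : entries (tuple_of k n) = n.
    by apply: tuple_ofK => i; rewrite -nk leq_sum_entry.
  have rk : (r < k + 333)%N by move: rf; rewrite /fibre; case: ifP => _; lia.
  exists (tuple_of k n, Ordinal rk); last by rewrite /decode /= nE.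
  by rewrite /= !inE /= nE nk eqxx.
move=> [[t r]]; rewrite /= !inE /= => /andP[/eqP tk rf] <-.
by apply/(lattice_points_dilateQ _ k0); exists (entries t), r.
Qed.

Lemma is_ehrhart_QQ (R : realType) :
  is_ehrhart (cartesian (Q R) (Q R)) (ehrhartQ ^+ 2).
Proof.
move=> k k0; exists (countQ k ^ 2)%N; last by rewrite horner_exp horner_ehrhartQ natrX.
rewrite dilate_cartesian lattice_points_cartesian !lattice_points_dilateQ_decode //.
pose f (p : (30.-tuple 'I_k.+1 * 'I_(k + 333)) * (30.-tuple 'I_k.+1 * 'I_(k + 333))) :=
  row_mx (decode R p.1) (decode R p.2).
have -> : cartesian (@decode R k @` [set` codes k]) (@decode R k @` [set` codes k]) =
    f @` [set` finset.setX (codes k) (codes k)].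
  apply/seteqP; split=> x.
    move=> [[p pk px] [q qk qx]]; exists (p, q).
      by rewrite /= finset.in_setX; apply/andP.
    by rewrite /f /= px qx hsubmxK.
  move=> [[p q]] /=; rewrite finset.in_setX => /andP[/= pk qk] <-.
  by split; rewrite /f /= ?row_mxKl ?row_mxKr; [exists p|exists q].
have -> : (countQ k ^ 2 = #|finset.setX (codes k) (codes k)|)%N.
  by rewrite cardsX card_codes mulnn.
apply: card_image_finset => -[p q] [p' q'].
rewrite !finset.in_setX => /andP[/= pk qk] /andP[/= p'k q'k].
by rewrite /f /= => /eq_row_mx[/(decode_inj pk p'k)-> /(decode_inj qk q'k)->].
Qed.

(** * Decomposing lattice points *)

(** A multiset of size k can be listed by the k first integers. *)
Lemma enum_multiset (V : nmodType) (I : finType) (i0 : I) (n : I -> nat) k :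
  (\sum_i n i = k)%N ->
  exists a : 'I_k -> I, forall F : I -> V, \sum_j F (a j) = \sum_i F i *+ n i.
Proof.
move=> nk; pose s := flatten [seq nseq (n i) i | i <- enum I].
have sE (W : nmodType) (F : I -> W) : \sum_(i <- s) F i = \sum_i F i *+ n i.
  rewrite /s big_flatten big_map big_enum /=; apply: eq_bigr => i _.
  by rewrite big_nseq iter_addr addr0.
have sk : size s = k.
  rewrite -sum1_size -nk (sE _ (fun=> 1%N)); apply: eq_bigr => i _.
  exact: natn.
exists (fun j => nth i0 s j) => F.
by rewrite -sE (big_nth i0) sk big_mkord.
Qed.

Lemma genQ_lattice_point (R : realType) ib : lattice_points (Q R) (genQ R ib).
Proof.
split; first by rewrite Q_conv; exact: conv_range_gen.
move=> j; rewrite -[j]splitK; case: (fintype.split j) => i /=.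
  by rewrite row_mxEl !mxE rpredD ?rpred_nat.
by rewrite row_mxEr !mxE ord1 mulr1n rpredD ?rpredM ?rpred_nat.
Qed.

(** Take each edge i with multiplicity n_i, and choose the upper end for the
first r of the k summands. *)
Lemma sum_lattice_pt (R : realType) k n r : (\sum_i n i = k)%N -> (r <= k)%N ->
  sum_of_lattice_points (Q R) k (lattice_pt R n r).
Proof.
move=> nk rk; have [a aE] := enum_multiset 'rV[R]_(30 + 1) ord0 nk.
exists (fun j => genQ R (a j, (j < r)%N)); first by move=> j; exact: genQ_lattice_point.
have genE i b : genQ R (i, b) = genQ R (i, false) + row_mx 0 (b%:R)%:M.
  by rewrite /genQ add_row_mx addr0 -raddfD addr0.
have -> : \sum_(j < k) genQ R (a j, (j < r)%N) =
    \sum_(j < k) genQ R (a j, false) + \sum_(j < k) row_mx 0 ((j < r)%N%:R)%:M.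
  by rewrite -big_split /=; apply: eq_bigr => j _; exact: genE.
have -> : \sum_(j < k) row_mx 0 ((j < r)%N%:R)%:M
    = row_mx 0 (r%:R)%:M :> 'rV[R]_(30 + 1).
  rewrite (row_mx_sum xpredT) big1 // -raddf_sum; congr (row_mx _ (_ %:M)).
  rewrite -natr_sum; congr (_%:R).
  transitivity (\sum_(j < k | (j < r)%N) 1)%N.
    by rewrite [RHS]big_mkcond; apply: eq_bigr => j _; case: ltnP.
  by rewrite -(big_ord_widen k (fun=> 1%N)) // sum1_card card_ord.
rewrite (aE (fun i => genQ R (i, false))).
under eq_bigr do rewrite /genQ -scaler_nat scale_row_mx scale_scalar_mx.
rewrite (row_mx_sum xpredT) -raddf_sum add_row_mx addr0 -raddfD.
rewrite /lattice_pt /comb /=; congr (row_mx _ (_ %:M)).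
congr (_ + _); rewrite (bigD1 ord0) //= big1 ?addr0 => [|i /negPf->].
  by rewrite mulr1n mulr1 mulrC.
by rewrite !mulr0 ?addr0 ?mulr0.
Qed.

(** From k = 331 on the windows of consecutive representations leave no hole. *)
Lemma very_ample_Q (R : realType) : very_ample (Q R).
Proof.
exists 331%N => // k k331 x; have k0 : (0 < k)%N by apply: leq_trans k331.
move=> /(lattice_points_dilateQ _ k0)[n [r [nk rf ->]]].
apply: sum_lattice_pt => //; rewrite -ltnS (leq_trans rf) // /fibre.
by case: ifP.
Qed.

Lemma dilate_1 (R : realType) n (P : set 'rV[R]_n) : dilate 1 P = P.
Proof.
apply/seteqP; split=> [_ [x Px <-]|x Px]; first by rewrite scale1r.
by exists x; rewrite // scale1r.
Qed.

(** In Q itself no representation can be moved up, for that takes sum at least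
15; so heights are those of the generators. *)
Lemma height_Q (R : realType) x : lattice_points (Q R) x ->
  exists2 h : nat, x 0 (rshift 30 0) = h%:R & (h <= 1)%N || (332 <= h)%N.
Proof.
rewrite -[Q R]dilate_1 => /(lattice_points_dilateQ _ (ltn0Sn 0))[n [r [n1 rf ->]]].
exists (332 * n ord0 + r)%N.
  by rewrite /lattice_pt comb_height (natrD _ (332 * n ord0)%N) (natrM _ 332).
move: rf; rewrite /fibre; case: ifP => [/forallP np _|_]; last first.
  by case: (n ord0) => [|m]; lia.
have : (\sum_(i < 30) odd i <= \sum_i n i)%N.
  by apply: leq_sum => i _; have := np i; case: odd.
by rewrite sum_odd n1.
Qed.

(** The height 16 over the base point (1,...,1) in 15Q: a sum of 15 heights from
{0, 1} is at most 15, and one summand of height 332 is already too much. *)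
Lemma not_IDP_Q (R : realType) : ~ IDP (Q R).
Proof.
move=> /(_ 15 isT (lattice_pt R (fun i => odd i) 16))[].
  apply/lattice_points_dilateQ => //.
  exists (fun i : 'I_30 => odd i : nat), 16%N; split=> //.
    exact: sum_odd.
  rewrite /fibre; case: ifP => // /negP[]; apply/forallP => i; apply/implyP => ->; done.
move=> p pQ E.
have /choice[h hE] : forall j, exists h : nat,
    p j 0 (rshift 30 0) = h%:R /\ ((h <= 1)%N || (332 <= h)%N).
  by move=> j; have [h] := height_Q (pQ j); exists h.
have : (\sum_j h j = 16)%N.
  apply/eqP; rewrite -(eqr_nat R) natr_sum.
  have := congr1 (fun x : 'rV[R]_(30 + 1) => x 0 (rshift 30 0)) E.
  rewrite /= /lattice_pt comb_height mulr0 add0r summxE => ->.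
  by apply/eqP; apply: eq_bigr => j _; have [->] := hE j.
case: (boolP [forall j, (h j <= 1)%N]) => [/forallP h1|].
  have : (\sum_j h j <= \sum_(j < 15) 1)%N by apply: leq_sum => j _.
  rewrite sum1_card card_ord; lia.
rewrite negb_forall => /existsP[j]; have [_] := hE j.
move=> /orP[->//|hj _] hs.
have : (h j <= \sum_j h j)%N by rewrite (bigD1 j) //= leq_addr.
by rewrite hs; lia.
Qed.

(** * Vertices and dimension *)

(** The edge u_i has inner product 2 with itself and at most 1 with any other,
since on a cycle of length at least 3 distinct edges share at most one vertex.
The factor 1000 lets this gap beat all differences of heights, which are at
most 333; the sign then selects the end of the segment. *)
Lemma exposed_genQ (R : realType) : exposed (genQ R).
Proof.
move=> [i b].
have ordSN (j : 'I_30) : (ordS j == j) = false.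
  apply/negP => /eqP/(congr1 (fun j : 'I_30 => nat_of_ord j)) /=.
  by have := ltn_ord j; lia.
have ordSSN (j : 'I_30) : (ordS (ordS j) == j) = false.
  apply/negP => /eqP/(congr1 (fun j : 'I_30 => nat_of_ord j)) /=.
  by have := ltn_ord j; lia.
exists (col_mx (1000 *: (u R i)^T) ((-1) ^+ (~~ b))%:M) => -[j c].
have uu j' : (u R j' *m (u R i)^T) 0 0 =
    (j' == i)%:R + (ordS j' == i)%:R + ((j' == ordS i)%:R + (j' == i)%:R).
  have uE l : u R j' 0 l = (j' == l)%:R + (ordS j' == l)%:R.
    by rewrite !mxE /= ![l == _]eq_sym.
  have -> : (u R i)^T = delta_mx i 0 + delta_mx (ordS i) 0.
    by rewrite linearD /= !trmx_delta.
  have col l : (u R j' *m delta_mx l 0) 0 0 = u R j' 0 l.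
    rewrite mxE (bigD1 l) //= big1 => [|m /negPf ml]; last first.
      by rewrite [delta_mx _ _ _ _]mxE ml mulr0.
    by rewrite [delta_mx _ _ _ _]mxE !eqxx mulr1 addr0.
  by rewrite mulmxDr mxE !col !uE (can_eq (@ordSK _)).
have val j' c' :
    (genQ R (j', c') *m col_mx (1000 *: (u R i)^T) ((-1) ^+ (~~ b))%:M) 0 0 =
    1000 * (u R j' *m (u R i)^T) 0 0 +
    (-1) ^+ (~~ b) * (332 * (j' == ord0)%:R + c'%:R).
  by rewrite mul_row_col -scalemxAr mul_mx_scalar !mxE mulr1n.
rewrite xpair_eqE negb_and !val; have [->/= cb|ji _] := eqVneq j i.
  rewrite ltrD2l; case: b c cb {uu val} => -[] //= _.
    by rewrite !expr0 !mul1r ltrD2l ltr01.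
  by rewrite !expr1 !mulN1r ltrN2 ltrD2l ltr01.
have si : (u R i *m (u R i)^T) 0 0 = 2.
  by rewrite uu eqxx ordSN eq_sym ordSN addr0 add0r.
have sj : (u R j *m (u R i)^T) 0 0 <= 1.
  rewrite uu (negPf ji) add0r addr0.
  have [ij|] := eqVneq (ordS j) i; last by rewrite add0r lern1 leq_b1.
  by rewrite -ij eq_sym ordSSN addr0.
rewrite si; move: (_ 0 0) sj => s sj.
have h0 j' (c' : bool) : 0 <= 332 * (j' == ord0 :> 'I_30)%:R + c'%:R :> R.
  by rewrite addr_ge0 // mulr_ge0.
have h1 j' (c' : bool) : 332 * (j' == ord0 :> 'I_30)%:R + c'%:R <= 333 :> R.
  have -> : 333 = 332 + 1 :> R by ring.
  by apply: lerD; rewrite ?ler_piMr ?lern1 ?leq_b1.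
move: (h0 i b) (h1 i b) (h0 j c) (h1 j c).
move: (332 * (i == _)%:R + _) (332 * (j == _)%:R + _) => x y.
by case: b {uu val} => /=; rewrite ?expr0 ?expr1; lra.
Qed.

(** Edge coordinates of sum 0 together with a free height form a space of
dimension 30; exactly the line spanned by the alternating vector is lost when
passing to directions of Q, because that vector has sum 0. *)
Lemma has_dim_Q (R : realType) : has_dim (Q R) 29.
Proof.
have QE x : Q R x <-> exists (l : 'I_30 -> R) (z : R),
    [/\ forall i, 0 <= l i, \sum_i l i = 1,
        332 * l ord0 <= z <= 332 * l ord0 + 1 & x = comb l z].
  by rewrite -[Q R]dilate_1; exact: dilateQ.
split.
  by exists (genQ R (ord0, false)); exact: (genQ_lattice_point R (ord0, false)).1.
pose f : 'Hom('rV[R]_(30 + 1), 'rV[R]_(30 + 1)) :=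
  linfun (mulmxr (block_mx (\matrix_i u R i) 0 0 1%:M)).
pose g : 'Hom('rV[R]_(30 + 1), 'rV[R]_1) := linfun (mulmxr (col_mx (const_mx 1) 0)).
have fE y : f y = comb (fun i => y 0 (lshift 1 i)) (y 0 (rshift 30 0)).
  rewrite lfunE /= -[y in LHS]hsubmxK mul_row_block !mulmx0 addr0 add0r mulmx1.
  rewrite mulmx_sum_row.
  congr row_mx; last by apply/rowP => j; rewrite ord1 !mxE eqxx mulr1n.
  by apply: eq_bigr => i _; rewrite rowK mxE.
have gE y : g y = (\sum_i y 0 (lshift 1 i))%:M.
  rewrite lfunE /= -[y in LHS]hsubmxK mul_row_col mulmx0 addr0.
  apply/rowP => j; rewrite ord1 !mxE eqxx mulr1n.
  by apply: eq_bigr => i _; rewrite !mxE mulr1.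
pose row (l : 'I_30 -> R) z : 'rV[R]_(30 + 1) := row_mx (\row_i l i) z%:M.
have frow l z : f (row l z) = comb l z.
  rewrite fE /row row_mxEr mxE eqxx mulr1n; congr comb.
  by apply/funext => i; rewrite row_mxEl mxE.
have grow l z : (row l z \in lker g) = (\sum_i l i == 0).
  rewrite memv_ker gE; under eq_bigr do rewrite row_mxEl mxE.
  apply/eqP/eqP => [/rowP/(_ 0)|->]; last by rewrite raddf0.
  by rewrite !mxE eqxx mulr1n.
have rowE (y : 'rV[R]_(30 + 1)) :
    y = row (fun i => y 0 (lshift 1 i)) (y 0 (rshift 30 0)).
  rewrite /row -[LHS]hsubmxK; congr row_mx; apply/rowP => i; rewrite !mxE //.
  by rewrite ord1 eqxx mulr1n.
exists (f @: lker g)%VS; split.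
- have kg : \dim (lker g) = 30%N.
    have gfull : limg g = fullv.
      apply/eqP; rewrite eqEsubv subvf; apply/subvP => y _.
      suff -> : y = g (row (fun i => (i == ord0)%:R * y 0 0) 0).
        by rewrite memv_img ?memvf.
      rewrite gE [LHS]mx11_scalar; congr _%:M.
      under eq_bigr do rewrite row_mxEl mxE.
      by rewrite -mulr_suml (bigD1 ord0) //= big1 ?addr0 ?mul1r // => i /negPf->.
    have := limg_ker_dim g fullv; rewrite capfv gfull !dimvf !dim_matrix.
    exact: (@addIn 1 _ 30).
  have kf : (lker g :&: lker f = <[row (altsign R) 0%R]>)%VS.
    apply/vspaceP => y; rewrite memv_cap; apply/andP/vlineP => [|[c ->]].
      rewrite (rowE y) grow memv_ker frow => -[_ /eqP].
      have {1}<- : comb (fun=> 0) 0 = 0 :> 'rV[R]_(30 + 1).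
        rewrite /comb big1 => [|i _]; last by rewrite scale0r.
        by rewrite raddf0 row_mx0.
      move=> /comb_eq[-> [c lE]]; exists c.
      rewrite /row scale_row_mx scale_scalar_mx mulr0; congr row_mx.
      by apply/rowP => i; rewrite [LHS]mxE lE !mxE add0r mulrC.
    have -> : c *: row (altsign R) 0 = row (fun i => 0 + altsign R i * c) 0.
      rewrite /row scale_row_mx scale_scalar_mx mulr0; congr row_mx.
      by apply/rowP => i; rewrite !mxE add0r mulrC.
    rewrite grow memv_ker frow comb_altsign; split.
      by under eq_bigr do rewrite add0r; rewrite -mulr_suml sum_altsign mul0r.
    rewrite /comb big1 => [|i _]; last by rewrite scale0r.
    by rewrite raddf0 row_mx0.
  have row0 : row (altsign R) 0 != 0.
    apply/eqP => /rowP/(_ (lshift 1 ord0))/eqP.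
    by rewrite row_mxEl !mxE altsign0 oner_eq0.
  have := limg_ker_dim f (lker g); rewrite kf kg dim_vline row0 add1n.
  by case.
- move=> x y /QE[l [z [_ l1 _ ->]]] /QE[l' [z' [_ l'1 _ ->]]].
  rewrite -!frow -linearB; apply: memv_img.
  have -> : row l z - row l' z' = row (fun i => l i - l' i) (z - z').
    rewrite /row opp_row_mx add_row_mx -raddfB; congr row_mx.
    by apply/rowP => i; rewrite !mxE.
  by rewrite grow sumrB l1 l'1 subrr.
move=> W PW; apply/subvP => _ /memv_imgP[y + ->].
rewrite (rowE y); move: (fun i => y 0 _) (y 0 _) => l z.
rewrite grow frow => /eqP l0.
have gQ ib : Q R (genQ R ib) by exact: (genQ_lattice_point R ib).1.
have -> : comb l z = \sum_i l i *: (genQ R (i, false) - genQ R (ord0, false))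
   + (z - 332 * l ord0) *: (genQ R (ord0, true) - genQ R (ord0, false)).
  under eq_bigr do rewrite scalerBr.
  rewrite sumrB -scaler_suml l0 scale0r subr0.
  have -> : genQ R (ord0, true) - genQ R (ord0, false) = row_mx 0 1%:M.
    rewrite /genQ opp_row_mx add_row_mx subrr -raddfB; congr (row_mx _ _%:M).
    by rewrite /= addr0 addrAC subrr add0r.
  under eq_bigr do rewrite scale_row_mx scale_scalar_mx.
  rewrite (row_mx_sum xpredT) -raddf_sum scale_row_mx scale_scalar_mx scaler0.
  rewrite add_row_mx addr0 -raddfD /comb; congr (row_mx _ _%:M).
  have -> : \sum_i l i * (332 * (i == ord0)%:R + false%:R) = 332 * l ord0.
    rewrite (bigD1 ord0) //= big1 ?addr0 => [|i /negPf->].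
      by rewrite mulr1n mulr1 mulrC.
    by rewrite mulr0 addr0 mulr0.
  by rewrite mulr1 addrC subrK.
rewrite memvD ?memvZ ?PW // memv_suml // => i _.
by rewrite memvZ ?PW.
Qed.

Theorem theorem1p3 (R : realType) :
  [/\ lattice_polytope (cartesian (Q R) (Q R)),
      has_dim (cartesian (Q R) (Q R)) 58,
      vertices (cartesian (Q R) (Q R)) #= `I_3600
    & [/\ very_ample (cartesian (Q R) (Q R)),
          ~ IDP (cartesian (Q R) (Q R))
        & nonunimodal_hstar (cartesian (Q R) (Q R))]].
Proof.
have dimQQ : has_dim (cartesian (Q R) (Q R)) 58 :=
  has_dim_cartesian (has_dim_Q R) (has_dim_Q R).
have QQ : cartesian (Q R) (Q R) =
    conv (range (fun ij => row_mx (genQ R ij.1) (genQ R ij.2))).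
  by rewrite Q_conv cartesian_conv_range.
split=> //; last split.
- exists (range (fun ij => row_mx (genQ R ij.1) (genQ R ij.2))); split=> //.
    exact: finite_image.
  move=> _ [[i j] _ <-].
  have [] : lattice_points (cartesian (Q R) (Q R)) (row_mx (genQ R i) (genQ R j)).
    rewrite lattice_points_cartesian /cartesian /= row_mxKl row_mxKr.
    by split; exact: genQ_lattice_point.
  by [].
- rewrite QQ.
  have := card_vertices_conv_range
    (exposed_cartesian (@exposed_genQ R) (@exposed_genQ R)).
  by rewrite !card_prod card_ord card_bool.
- exact/very_ample_cartesian/very_ample_Q/very_ample_Q.
- move=> /IDP_cartesianl IDPQ; apply/not_IDP_Q/IDPQ.
  by exists (genQ R (ord0, false)); exact: genQ_lattice_point.
exists 58%N, hstarQQ; split.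
  exact: is_hstar_ehrhart dimQQ (is_ehrhart_QQ R) size_ehrhartQQ.
move=> [j _ [up down]]; have [lt25 lt27] := hstarQQ_dip.
have [j26|j26] := leqP j 26.
  have := down 26%N; rewrite j26 => /(_ isT).
  by rewrite leNgt lt27.
by have := up 25%N (ltnW j26); rewrite leNgt lt25.
Qed.
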